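(* Let $n$ be a positive integer, and let $\mathcal F$ be a family (set) of lattice paths from $(0,0)$ to $(n,n)$ such that $|F\cap G|$ is even for every two distinct $F,G\in\mathcal F$. Then $|\mathcal F|\le 2^n$. Moreover the bound is attained: for every positive integer $n$ there is such a family with exactly $2^n$ members.
   Context: A lattice path is a finite sequence of vertices $F=(v_0,v_1,\dots,v_k)\in(\mathbb Z^2)^{k+1}$ such that $v_i-v_{i-1}\in\{(0,1),(1,0)\}$ for all $1\le i\le k$ (a North-East lattice path; $N=(0,1)$, $E=(1,0)$). It is a path from $v_0$ to $v_k$. Its edge set is $E(F)=\{\{v_i,v_{i+1}\}:0\le i<k\}$. For two lattice paths $F,G$ both starting at $(0,0)$, define $F\cap G:=E(F)\cap E(G)$, so that $|F\cap G|$ is the number of common edges of the two paths. *)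

(* Defs.v *)
From HB Require Import structures.
From mathcomp Require Import all_boot all_order all_algebra.
From mathcomp Require Import finmap.
From mathcomp Require Import boolp classical_sets cardinality.

Set Implicit Arguments.
Unset Strict Implicit.
Unset Printing Implicit Defensive.

Import GRing.Theory.

Local Open Scope ring_scope.
Local Open Scope fset_scope.

Definition vertex : Type := (int * int)%type.

Definition north : vertex := (0, 1).
Definition east : vertex := (1, 0).

Definition step (u v : vertex) : bool := (v - u == north) || (v - u == east).

(* The sequence (v_0, ..., v_k) is the nonempty list [:: v_0; ...; v_k]. *)
Definition lattice_path (p : seq vertex) : bool :=
  if p is v :: s then path step v s else false.

Definition lattice_path_from_to (a b : vertex) (p : seq vertex) : bool :=
  lattice_path p && (if p is v :: s then (v == a) && (last v s == b) else false).

(* Edges are unordered pairs; [zip p (behead p)] lists the consecutive pairs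
   (v_i, v_{i+1}), and is empty when k = 0. *)
Definition edges (p : seq vertex) : {fset {fset vertex}} :=
  [fset [fset e.1; e.2] | e in zip p (behead p)].

Definition common_edges (p q : seq vertex) : nat := #|` edges p `&` edges q |.

Definition even_intersecting (F : set (seq vertex)) : Prop :=
  forall p q, F p -> F q -> p <> q -> ~~ odd (common_edges p q).

Definition paths_to_diag (n : nat) : set (seq vertex) :=
  [set p | lattice_path_from_to (0, 0) (n%:Z, n%:Z) p]%classic.

(* Main.v *)
Require Import Defs.
From mathcomp Require Import all_boot all_order all_algebra.
From mathcomp Require Import finmap.
From mathcomp Require Import boolp classical_sets cardinality.
From mathcomp Require Import zify.

(** Write a path as the word of its 2n steps. Two facts about the family carry
    the upper bound.

    Say that a path u of the family branches forward at step i if some member v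
    follows u before step i and leaves it there, and branches backward at step
    i if some member w follows u after step i and joins u there, by another
    edge. No u does both at the same i: modulo 2, and since every path has an
    even number of edges, the inner product of u + v and u + w is
    |u ∩ v| + |u ∩ w| + |v ∩ w|, even by hypothesis, whereas u + v
    lives on the steps from i on and u + w on the steps up to i, so that they
    can only meet at step i, where they have exactly the edge of u in common
    (shares_branch).

    Now fix the letters of a word u at its forward branching steps and free the
    others. This subcube of {0,1}^(2n) has 2^(2n - a(u)) points, with a(u) the
    number of forward branchings, and the subcubes of distinct u are disjoint
    because both words branch at the first letter where they differ. Hence the
    numbers 2^(2n - a(u)) sum to at most 2^(2n), and so do the 2^(2n - b(u))
    with b(u) the number of backward branchings (sum_disjoint_cubes). As
    a(u) + b(u) <= 2n, every u contributes at least 2^(n+1) to the two sums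
    together, which leaves room for at most 2^n words (card_opposite_cubes).

    The bound is attained by the paths that visit all the points (k, k): each
    of the n blocks is EN or NE, and two such paths have two or no common edges
    in each block. *)

Set Implicit Arguments.
Unset Strict Implicit.
Unset Printing Implicit Defensive.

Import GRing.Theory.

(** * Disjoint subcubes *)

(** A Kraft inequality: the left-hand side counts the points of the subcubes
    on which the coordinates in [D u] agree with [f u], and the hypothesis makes
    these subcubes disjoint. *)
Lemma sum_disjoint_cubes (I T : finType) (A : {set T}) (f : T -> I -> bool)
    (D : T -> {set I}) :
  {in A &, forall u v, u != v ->
    exists i, [/\ i \in D u, i \in D v & f u i <> f v i]} ->
  (\sum_(u in A) 2 ^ (#|I| - #|D u|) <= 2 ^ #|I|)%N.
Proof.
move=> sepA.
pose cube u := [set g : {ffun I -> bool} | [forall i in D u, g i == f u i]].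
have card_cube u : #|cube u| = (2 ^ (#|I| - #|D u|))%N.
  pose F i : pred bool := if i \in D u then pred1 (f u i) else predT.
  have -> : #|cube u| = #|family F|.
    apply: eq_card => g; rewrite inE; apply/forall_inP/familyP => gF i.
      by rewrite /F; case: ifP => // /gF /eqP ->; exact: eqxx.
    by move=> Dui; have := gF i; rewrite /F Dui.
  rewrite card_family foldrE big_map big_enum /= (bigID (mem (D u))) /=.
  rewrite big1 => [|i Dui]; last by rewrite /F Dui card1.
  rewrite mul1n (eq_bigr (fun=> 2%N)) => [|i /negbTE Dui]; last first.
    by rewrite /F Dui card_bool.
  rewrite prod_nat_const -(cardsC (D u)) addKn; congr (2 ^ _)%N.
  by apply: eq_card => i; rewrite !inE.
have {card_cube} cardE : (\sum_(u in A) 2 ^ (#|I| - #|D u|))%N =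
    (\sum_(g : {ffun I -> bool}) \sum_(u in A) (g \in cube u))%N.
  rewrite exchange_big; apply: eq_bigr => u _; rewrite -card_cube -sum1_card.
  by rewrite big_mkcond; apply: eq_bigr => g _; case: ifP.
have -> : (2 ^ #|I| = \sum_(g : {ffun I -> bool}) 1)%N.
  by rewrite sum1_card card_ffun card_bool.
rewrite cardE; apply: leq_sum => g _.
case: (pickP [pred u in A | g \in cube u]) => [u /andP[Au gu]|no]; last first.
  by rewrite big1 // => u Au; have := no u; rewrite /= Au => /= ->.
rewrite (bigD1 u) //= gu big1 // => v /andP[Av]; rewrite eq_sym => neq_uv.
have [i [Dui Dvi neq_i]] := sepA u v Au Av neq_uv.
case: (boolP (g \in cube v)) => //; move: gu; rewrite !inE.
move=> /forall_inP/(_ i Dui)/eqP gui /forall_inP/(_ i Dvi).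
by rewrite gui => /eqP.
Qed.

(** The inequality of arithmetic and geometric means, in the form needed here:
    the larger of the two powers alone suffices unless both exponents are at
    least [n]. *)
Lemma double_expn_le (n a b : nat) :
  (a + b <= n.*2 -> 2 ^ n.+1 <= 2 ^ (n.*2 - a) + 2 ^ (n.*2 - b))%N.
Proof.
move=> le_ab; case: (leqP a n) => [le_an|lt_na]; last first.
  apply: leq_trans (leq_addl _ _); rewrite leq_exp2l //; lia.
case: (leqP b n) => [le_bn|lt_nb]; last first.
  apply: leq_trans (leq_addr _ _); rewrite leq_exp2l //; lia.
by rewrite expnS mul2n -addnn leq_add // leq_exp2l //; lia.
Qed.

(** Two systems of disjoint subcubes that never fix a common coordinate of the
    same point: summing both Kraft inequalities, each point of [A] weighs at
    least [2 ^ n.+1] out of a total of [2 * 2 ^ n.*2]. *)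
Lemma card_opposite_cubes (n : nat) (I T : finType) (A : {set T})
    (f : T -> I -> bool) (D E : T -> {set I}) :
  #|I| = n.*2 ->
  {in A &, forall u v, u != v ->
    exists i, [/\ i \in D u, i \in D v & f u i <> f v i]} ->
  {in A &, forall u v, u != v ->
    exists i, [/\ i \in E u, i \in E v & f u i <> f v i]} ->
  {in A, forall u, [disjoint D u & E u]} ->
  (#|A| <= 2 ^ n)%N.
Proof.
move=> cardI sepD sepE disDE.
have [] := (sum_disjoint_cubes sepD, sum_disjoint_cubes sepE).
rewrite cardI => leD leE.
have sqE : (2 ^ n * 2 ^ n.+1 = 2 ^ n.*2 + 2 ^ n.*2)%N.
  by rewrite -expnD addnS addnn expnS mul2n addnn.
rewrite -(@leq_pmul2r (2 ^ n.+1)) ?expn_gt0 // sqE.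
apply: leq_trans (leq_add leD leE); rewrite -big_split -sum_nat_const /=.
apply: leq_sum => u Au; apply: double_expn_le.
have := disDE u Au; rewrite -(geq_leqif (leq_card_setU _ _)).
move=> /leq_trans; apply.
by rewrite -cardI max_card.
Qed.

(** * Words and the paths they describe *)

Local Open Scope ring_scope.

Definition stride (b : bool) : vertex := if b then east else north.

(** Words are functions on [nat], so that prefixes and suffixes need no casts;
    only the letters below the length of the path matter. *)
Definition vertex_at (w : nat -> bool) (k : nat) : vertex :=
  \sum_(j < k) stride (w j).

Definition walk (L : nat) (w : nat -> bool) : seq vertex :=
  mkseq (vertex_at w) L.+1.

Lemma stride_inj : injective stride.
Proof. by do 2![case]. Qed.

Lemma vertex_atS w k : vertex_at w k.+1 = vertex_at w k + stride (w k).
Proof. by rewrite /vertex_at big_ord_recr. Qed.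

(** The coordinate sum recovers the time at which a vertex is visited, hence
    two paths can only meet at equal times. *)
Lemma vertex_at_degree w k : (vertex_at w k).1 + (vertex_at w k).2 = k%:Z.
Proof.
elim: k => [|k IHk]; first by rewrite /vertex_at big_ord0.
by rewrite vertex_atS /=; case: (w k) => /=; lia.
Qed.

Lemma vertex_at_inj u v i j : vertex_at u i = vertex_at v j -> i = j.
Proof.
by move=> e; have := vertex_at_degree u i; rewrite e vertex_at_degree => -[].
Qed.

Lemma eq_vertex_at u v k :
  (forall j, (j < k)%N -> u j = v j) -> vertex_at u k = vertex_at v k.
Proof. by move=> uv; apply: eq_bigr => j _; rewrite uv. Qed.

Lemma eq_vertex_at_rev L u v k : (k <= L)%N -> vertex_at u L = vertex_at v L ->
  (forall j, (k <= j < L)%N -> u j = v j) -> vertex_at u k = vertex_at v k.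
Proof.
move=> + + uv; elim: L uv => [|L IHL] uv; first by rewrite leqn0 => /eqP ->.
rewrite leq_eqVlt => /predU1P[-> //|lekL]; rewrite !vertex_atS.
rewrite (uv L) => [/addIr uvL|]; last by rewrite ltnSn andbT.
by apply: IHL => // j /andP[kj jL]; apply: uv; rewrite kj leqW.
Qed.

Lemma walk_inj L u v i : walk L u = walk L v -> (i < L)%N -> u i = v i.
Proof.
move=> uv iL; have posE k : (k <= L)%N -> vertex_at u k = vertex_at v k.
  by move=> kL; have := congr1 (nth 0 ^~ k) uv; rewrite !nth_mkseq.
apply: stride_inj; apply: (@addrI _ (vertex_at u i)).
rewrite -vertex_atS posE //.
by rewrite vertex_atS posE // ltnW.
Qed.

Lemma eq_walk L u v : (forall i, (i < L)%N -> u i = v i) -> walk L u = walk L v.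
Proof.
move=> uv; apply: (@eq_from_nth _ 0) => [|i]; rewrite !size_mkseq // => iL.
rewrite !nth_mkseq //; apply: eq_vertex_at => j ji.
by apply: uv; apply: leq_trans ji iL.
Qed.

Lemma stepP a b : reflect (exists c, b = a + stride c) (step a b).
Proof.
apply: (iffP orP) => [[] /eqP e|[[] ->]].
- by exists false; rewrite -[stride _]e addrC subrK.
- by exists true; rewrite -[stride _]e addrC subrK.
- by right; rewrite addrC addKr.
- by left; rewrite addrC addKr.
Qed.

Lemma walk_paths_to_diag n w :
  vertex_at w n.*2 = (n%:Z, n%:Z) -> paths_to_diag n (walk n.*2 w).
Proof.
move=> wn; have walkE : walk n.*2 w =
    vertex_at w 0 :: mkseq (fun i => vertex_at w i.+1) n.*2.
  by rewrite /walk /mkseq /= -add1n iotaDl -map_comp.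
suff : lattice_path_from_to (0, 0) (n%:Z, n%:Z) (walk n.*2 w) by [].
rewrite walkE /lattice_path_from_to /lattice_path.
apply/and3P; split.
- apply/(pathP 0) => i; rewrite size_mkseq => iL; rewrite -walkE !nth_mkseq //=.
    by apply/stepP; exists (w i); rewrite vertex_atS.
  exact: ltnW.
- by rewrite /vertex_at big_ord0.
rewrite -nth_last size_mkseq; apply/eqP; rewrite -[RHS]wn.
case: n {wn walkE} => [//|n]; rewrite nth_mkseq //.
Qed.

Lemma paths_to_diag_walk n p : paths_to_diag n p ->
  exists2 w, p = walk n.*2 w & vertex_at w n.*2 = (n%:Z, n%:Z).
Proof.
rewrite /paths_to_diag /lattice_path_from_to /=; case: p => // v s.
case/andP=> /= /(pathP 0) vs /andP[/eqP v0 /eqP lastE].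
pose w i := nth 0 s i - nth 0 (v :: s) i == east.
have posE i : (i <= size s)%N -> vertex_at w i = nth 0 (v :: s) i.
  elim: i => [|i IHi] iL; first by rewrite /vertex_at big_ord0 v0.
  have /stepP[c cE] := vs i iL; rewrite vertex_atS IHi ?(ltnW iL) //= cE.
  congr (_ + stride _); rewrite /w cE addrC addKr; by case: (c).
have posL : vertex_at w (size s) = (n%:Z, n%:Z).
  by rewrite posE // -lastE (last_nth 0).
have sizeE : size s = n.*2.
  by have := vertex_at_degree w (size s); rewrite posL /=; lia.
exists w; rewrite -?sizeE //; apply: (@eq_from_nth _ 0).
  by rewrite size_mkseq.
by move=> i iL; rewrite nth_mkseq // posE.
Qed.

(** * Common edges *)

Definition shares (u v : nat -> bool) (i : nat) : bool :=
  (vertex_at u i == vertex_at v i) && (vertex_at u i.+1 == vertex_at v i.+1).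

Lemma zip_map_iota_succ (T : Type) (g : nat -> T) m L :
  zip [seq g i | i <- iota m L.+1] [seq g i | i <- iota m.+1 L] =
  [seq (g i, g i.+1) | i <- iota m L].
Proof. by elim: L m => [|L IHL] m //=; congr (_ :: _); exact: (IHL m.+1). Qed.

Lemma edges_walkP L w x :
  reflect (exists i : 'I_L, x = [fset vertex_at w i; vertex_at w i.+1]%fset)
          (x \in edges (walk L w)).
Proof.
rewrite /edges /walk /mkseq [behead _]/= zip_map_iota_succ.
apply: (iffP (imfsetP _ _ _ _)) => [[_ /mapP[i + ->] ->]|[i ->]].
  by rewrite mem_iota => /= iL; exists (Ordinal iL).
exists (vertex_at w i, vertex_at w i.+1) => //=.
by apply/mapP; exists (val i) => //; rewrite mem_iota add0n ltn_ord.
Qed.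

(** Although edges are unordered, the coordinate sums tell their endpoints
    apart. *)
Lemma edge_eq u v i j :
  [fset vertex_at u i; vertex_at u i.+1]%fset =
  [fset vertex_at v j; vertex_at v j.+1]%fset :> {fset vertex} ->
  i = j /\ shares u v i.
Proof.
move=> /fsetP uv.
have: vertex_at u i \in [fset vertex_at v j; vertex_at v j.+1]%fset.
  by rewrite -uv !inE eqxx.
have: vertex_at u i.+1 \in [fset vertex_at v j; vertex_at v j.+1]%fset.
  by rewrite -uv !inE eqxx orbT.
rewrite !inE => /orP[] /eqP e2 /orP[] /eqP e1; have := vertex_at_inj e1;
  have := vertex_at_inj e2; try lia.
by move=> _ eij; rewrite /shares {3}eij e1 e2 eij !eqxx.
Qed.

(** This replaces sets of edges by a sum over time, in which parities can be
    compared term by term. *)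
Lemma common_edges_walk L u v :
  common_edges (walk L u) (walk L v) = (\sum_(i < L) shares u v i)%N.
Proof.
pose P := [set i : 'I_L | shares u v i]%SET.
have -> : (\sum_(i < L) shares u v i)%N = #|P|.
  rewrite -sum1_card [RHS]big_mkcond; apply: eq_bigr => i _.
  by rewrite inE; case: shares.
rewrite /common_edges.
have -> : (edges (walk L u) `&` edges (walk L v) =
   [fset [fset vertex_at u (val i); vertex_at u (val i).+1] | i in P])%fset.
  apply/fsetP => x; rewrite inE; apply/andP/imfsetP => /=.
    move=> [/edges_walkP[i ->] /edges_walkP[j /edge_eq[eij sh]]].
    by exists i; rewrite // inE.
  move=> [i]; rewrite inE => /andP[/eqP e1 /eqP e2] ->; split.
    by apply/edges_walkP; exists i.
  by apply/edges_walkP; exists i; rewrite // e1 e2.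
rewrite card_imfset /=; last by move=> i j /edge_eq[/val_inj].
by rewrite cardE.
Qed.

(** The inner product of [u + v] and [u + w] computed edge by edge: before step
    [i] the words [u] and [v] share everything, after step [i] the words [u]
    and [w] do, and at step [i] no two of the three paths share their edge. When
    [L] is even, the three numbers of common edges cannot all be even. *)
Lemma shares_branch L u v w i : (i < L)%N -> vertex_at u L = vertex_at w L ->
  (forall j, (j < i)%N -> u j = v j) -> u i <> v i ->
  (forall j, (i < j < L)%N -> u j = w j) -> u i <> w i ->
  ((\sum_(j < L) shares u v j + \sum_(j < L) shares u w j).+1 =
   \sum_(j < L) shares v w j + L)%N.
Proof.
move=> iL uwL uv uvi uw uwi.
have posV j : (j <= i)%N -> vertex_at u j = vertex_at v j.
  by move=> ji; apply: eq_vertex_at => k kj; apply/uv/(leq_trans kj).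
have posW j : (i < j <= L)%N -> vertex_at u j = vertex_at w j.
  move=> /andP[ij jL]; apply: (eq_vertex_at_rev jL) => // k /andP[jk kL].
  by apply: uw; rewrite kL (leq_trans ij).
have splitV : vertex_at u i.+1 != vertex_at v i.+1.
  by rewrite !vertex_atS posV //; apply/eqP => /addrI/stride_inj.
(* The two paths coincide again after step [i], by different steps. *)
have splitW : vertex_at u i != vertex_at w i.
  apply/eqP => e; have := posW i.+1; rewrite ltnSn iL !vertex_atS e.
  by move=> /(_ isT)/addrI/stride_inj.
have delta : (\sum_(j < L) (j == i :> nat) = 1)%N.
  rewrite (bigD1 (Ordinal iL)) //= eqxx big1 // => j.
  by rewrite -val_eqE /= => /negbTE ->.
transitivity (\sum_(j < L) (shares v w j + 1))%N; last first.
  by rewrite big_split /= sum1_card card_ord.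
rewrite -[LHS]addn1 -[in LHS]delta -!big_split /=.
apply: eq_bigr => j _; rewrite /shares.
case: (ltngtP j i) => [ji|ij|->].
- by rewrite !posV ?(ltnW ji) // !eqxx; lia.
- rewrite !posW ?ij ?(ltnW ij) ?(ltnW (ltn_ord j)) ?ltn_ord ?(leqW ij) //.
  rewrite !eqxx ![_ == vertex_at v _]eq_sym; lia.
rewrite -posV // -(posW i.+1) ?ltnSn //.
by rewrite (negbTE splitV) (negbTE splitW) andbF.
Qed.

(** * The upper bound *)

Definition word L (t : L.-tuple bool) : nat -> bool := nth false t.

(** With [r] the order [ltn] these are the steps where another member of [A]
    leaves [u] after a common beginning; with [gtn], those where another member
    joins [u] before a common end. *)
Definition branching L (A : {set L.-tuple bool}) (r : rel nat)
    (u : L.-tuple bool) : {set 'I_L} :=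
  [set i : 'I_L | [exists v in A, (word u i != word v i) &&
    [forall j : 'I_L, r j i ==> (word u j == word v j)]]]%SET.

Lemma branchingP L (A : {set L.-tuple bool}) (r : rel nat) (u : L.-tuple bool)
    (i : 'I_L) :
  reflect (exists v, [/\ v \in A, word u i <> word v i &
             forall j, (j < L)%N -> r j i -> word u j = word v j])
          (i \in branching A r u).
Proof.
rewrite inE; apply: (iffP exists_inP) => -[v].
  move=> Av /andP[/eqP uvi /forall_inP uv]; exists v; split=> // j jL ji.
  exact/eqP/(uv (Ordinal jL)).
move=> [Av uvi uv]; exists v => //; apply/andP; split; first exact/eqP.
by apply/forall_inP => j ji; rewrite uv.
Qed.

(** The witness is an [r]-minimal position where the words differ: the first one
    for [ltn], the last one for [gtn]. *)
Lemma branching_separates L (A : {set L.-tuple bool}) (r : rel nat) :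
  (forall (P : pred 'I_L) i0, P i0 ->
     exists2 i, P i & forall j : 'I_L, r j i -> ~~ P j) ->
  {in A &, forall u v, u != v -> exists i : 'I_L,
     [/\ i \in branching A r u, i \in branching A r v & word u i <> word v i]}.
Proof.
move=> minimal u v Au Av; rewrite eqEtuple negb_forall => /existsP[i0].
move=> /(minimal (fun i => tnth u i != tnth v i))[i].
rewrite !(tnth_nth false) => /eqP uvi uv.
have {}uv j : (j < L)%N -> r j i -> word u j = word v j.
  by move=> jL /(uv (Ordinal jL)); rewrite !(tnth_nth false) negbK => /eqP.
exists i; split=> //; apply/branchingP; [exists v | exists u]; split=> //.
  exact/nesym.
by move=> j jL /(uv j jL).
Qed.

Lemma even_words_card n (A : {set n.*2.-tuple bool}) :
  {in A, forall u, vertex_at (word u) n.*2 = (n%:Z, n%:Z)} ->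
  {in A &, forall u v, u != v ->
    ~~ odd (\sum_(j < n.*2) shares (word u) (word v) j)} ->
  (#|A| <= 2 ^ n)%N.
Proof.
move=> endA evA.
(* A path has [n.*2] edges in common with itself, again an even number. *)
have {}evA : {in A &, forall u v : n.*2.-tuple bool,
    ~~ odd (\sum_(j < n.*2) shares (word u) (word v) j)}.
  move=> u v Au Av; have [<-|] := eqVneq u v; last exact: evA.
  under eq_bigr do rewrite /shares !eqxx.
  by rewrite sum1_card card_ord odd_double.
apply: (@card_opposite_cubes n 'I_(n.*2) (n.*2.-tuple bool) A
          (fun u i => word u i)
          (branching A ltn) (branching A gtn)).
- by rewrite card_ord.
- apply: branching_separates => P i0 Pi0.
  have [i Pi min_i] := arg_minnP (@nat_of_ord _) Pi0; exists i => // j.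
  by rewrite /= ltnNge; apply: contra => /min_i.
- apply: branching_separates => P i0 Pi0.
  have [i Pi max_i] := arg_maxnP (@nat_of_ord _) Pi0; exists i => // j.
  by rewrite /= ltnNge; apply: contra => /max_i.
move=> u Au; rewrite finset.disjoints_subset; apply/fintype.subsetP => i.
move=> /branchingP[v [Av uvi uv]]; rewrite finset.in_setC; apply/negP.
case/branchingP => w [Aw uwi uw].
have /(congr1 odd) : ((\sum_(j < n.*2) shares (word u) (word v) j +
    \sum_(j < n.*2) shares (word u) (word w) j).+1 =
   \sum_(j < n.*2) shares (word v) (word w) j + n.*2)%N.
  apply: (shares_branch (ltn_ord i)) => //; first by rewrite !endA.
    by move=> j ji; apply: uv => //; apply: ltn_trans ji _.
  by move=> j /andP[ij jL]; exact: uw.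
rewrite /= !oddD odd_double (negbTE (evA u v Au Av)) (negbTE (evA u w Au Aw)).
by rewrite (negbTE (evA v w Av Aw)).
Qed.

(** * A family that attains the bound *)

(** The path with blocks EN or NE: the second step of each block is the opposite
    of the first. *)
Definition zigzag (u : nat -> bool) (j : nat) : bool := u j./2 (+) odd j.

Lemma vertex_at_zigzag u k : vertex_at (zigzag u) k.*2 = (k%:Z, k%:Z).
Proof.
elim: k => [|k IHk]; first by rewrite /vertex_at big_ord0.
rewrite doubleS !vertex_atS IHk /zigzag /= uphalf_double odd_double doubleK.
by case: (u k) => /=; congr pair => /=; lia.
Qed.

Lemma shares_zigzag u v j :
  shares (zigzag u) (zigzag v) j = (u j./2 == v j./2).
Proof.
(* The paths pass through the same diagonal points, so that they share either
   both edges of a block or none, according to the point between them. *)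
have halfway k :
    (vertex_at (zigzag u) k.*2.+1 == vertex_at (zigzag v) k.*2.+1) =
    (u k == v k).
  rewrite !vertex_atS !vertex_at_zigzag (inj_eq (addrI _)) (inj_eq stride_inj).
  by rewrite /zigzag doubleK odd_double !addbF.
rewrite -[in LHS](odd_double_half j) /shares; case: (odd j) => /=.
  by rewrite add1n halfway -doubleS !vertex_at_zigzag eqxx andbT.
by rewrite add0n halfway !vertex_at_zigzag eqxx.
Qed.

Lemma even_shares_zigzag n u v :
  ~~ odd (\sum_(j < n.*2) shares (zigzag u) (zigzag v) j)%N.
Proof.
under eq_bigr do rewrite shares_zigzag.
elim: n => [|n IHn]; first by rewrite big_ord0.
rewrite doubleS !big_ord_recr /= uphalf_double doubleK -addnA addnn.
by rewrite oddD odd_double addbF.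
Qed.

(** * The extremal number *)

Lemma card_eq_finset (T : finType) (A : {set T}) :
  ([set x : T | x \in A]%classic #= `I_#|A|)%card.
Proof.
have -> : [set x : T | x \in A]%classic = [set` [fset x in A]%fset]%classic.
  by apply/seteqP; split => x /=; rewrite !inE.
by apply/card_eq_fsetP; rewrite card_imfset //= cardE.
Qed.

Local Open Scope classical_set_scope.
Local Open Scope card_scope.

Theorem theorem1p4 (n : nat) (hn : (0 < n)%N) :
  (forall F : set (seq vertex),
     F `<=` paths_to_diag n -> even_intersecting F -> F #<= `I_(2 ^ n)) /\
  (exists F : set (seq vertex),
     [/\ F `<=` paths_to_diag n, even_intersecting F & F #= `I_(2 ^ n)]).
Proof.
split.
  move=> F Fn evF.
  pose A := [set t : n.*2.-tuple bool | `[< F (walk n.*2 (word t)) >]]%SET.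
  have AF t : t \in A -> F (walk n.*2 (word t)) by rewrite inE => /asboolP.
  have FA : F `<=` (fun t => walk n.*2 (word t)) @` [set t | t \in A].
    move=> p Fp; have [w pE wn] := paths_to_diag_walk (Fn p Fp).
    have tE : walk n.*2 (word [tuple w i | i < n.*2]) = p.
      rewrite pE; apply: eq_walk => i iL.
      by rewrite /word -[i]/(val (Ordinal iL)) -tnth_nth tnth_mktuple.
    by exists [tuple w i | i < n.*2] => //=; rewrite inE tE; apply/asboolP.
  apply: card_le_trans (subset_card_le FA) _.
  apply: card_le_trans (card_image_le _ _) _.
  have := card_eq_finset A; rewrite card_eq_le => /andP[leA _].
  apply: card_le_trans leA _; rewrite card_le_II.
  apply: even_words_card => [u|u v] /AF Fu; last first.
    move=> /AF Fv neq_uv; rewrite -common_edges_walk; apply: evF => //.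
    move=> uv; case/eqP: neq_uv; apply: eq_from_tnth => i.
    by rewrite !(tnth_nth false); apply: walk_inj uv (ltn_ord i).
  have [w uw <-] := paths_to_diag_walk (Fn _ Fu).
  by have := congr1 (nth 0 ^~ n.*2) uw; rewrite !nth_mkseq.
exists (range (fun u : n.-tuple bool => walk n.*2 (zigzag (word u))));
  split.
- by move=> _ [u _ <-]; apply/walk_paths_to_diag/vertex_at_zigzag.
- move=> _ _ [u _ <-] [v _ <-] _.
  by rewrite common_edges_walk even_shares_zigzag.
apply: (@card_eq_trans _ _ _ _ [set: n.-tuple bool]).
  apply: inj_card_eq => u v _ _ uv; apply: eq_from_tnth => k.
  have := @walk_inj _ _ _ k.*2 uv; rewrite ltn_double ltn_ord => /(_ isT).
  by rewrite /zigzag doubleK odd_double !addbF !(tnth_nth false).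
have := card_eq_finset [set: n.-tuple bool]%SET.
rewrite cardsT card_tuple card_bool; congr (_ #= _).
by apply/seteqP; split => x //=; rewrite inE.
Qed.
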